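(* There is an absolute constant $C>0$ such that for all integers $r\ge 2$ and $k\ge 1$, \[L_r(k)\le C\,k^{3/2}\,r^{k/2}\log r .\] In particular, for every fixed $r\ge 2$ there is a constant $C_r>0$ depending only on $r$ such that $L_r(k)\le C_r\,k^{3/2}r^{k/2}$ for all $k\ge 1$.
   Context: $K_n$ denotes the complete graph on $n$ vertices. A $k$-edge-coloring of a graph is an arbitrary assignment of one of $k$ colors to each edge; a subgraph is monochromatic if all of its edges have the same color. $\chi(H)$ denotes the chromatic number of a graph $H$. The diameter $\operatorname{diam}(H)$ is the maximum over pairs $u,v\in V(H)$ of the length (number of edges) of a shortest path in $H$ between $u$ and $v$ (infinite if $H$ is disconnected). For integers $r\ge 2$, $k\ge 1$, $L_r(k)$ is the smallest integer $L$ such that every $k$-edge-coloring of $K_{r^k+1}$ contains a monochromatic subgraph $H$ (not necessarily induced or spanning) with $\chi(H)\ge r+1$ and $\operatorname{diam}(H)\le L$. *)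

(* Defs.v *)
From HB Require Import structures.
From mathcomp Require Import all_boot all_order all_algebra.
From mathcomp Require Import all_classical all_reals all_analysis.

Set Implicit Arguments.
Unset Strict Implicit.
Unset Printing Implicit Defensive.

Import Order.TTheory GRing.Theory Num.Theory.

Local Open Scope nat_scope.

(* A subgraph (not necessarily induced or spanning) of the complete graph
   on T; an edge is a two-element set of vertices. *)
Record subgraph (T : finType) := Subgraph {
  verts : {set T};
  edges : {set {set T}};
  edgesP : forall e, e \in edges -> (#|e| == 2) && (e \subset verts) }.

Section SubgraphInvariants.
Variables (T : finType) (H : subgraph T).

Definition adj : rel T := fun x y => [set x; y] \in edges H.

Definition colorable (m : nat) : Prop :=
  exists f : T -> nat,
    (forall x, x \in verts H -> f x < m) /\
    (forall x y, adj x y -> f x <> f y).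

Lemma adj_irr x : adj x x = false.
Proof.
by apply/negP => /edgesP/andP[]; rewrite finset.setUid cards1.
Qed.

Lemma ex_colorable : exists m, `[< colorable m >].
Proof.
exists #|T|; apply/asboolP; exists (fun x => val (enum_rank x)).
split=> [x _|x y xy]; first exact: ltn_ord.
by move=> /val_inj/enum_rank_inj exy; rewrite exy adj_irr in xy.
Qed.

Definition chi : nat := ex_minn ex_colorable.

Definition path_of_length (u v : T) (m : nat) : Prop :=
  exists p : seq T,
    [/\ path adj u p, last u p = v, uniq (u :: p) & size p = m].

Definition dist (u v : T) : \bar int :=
  match pselect (exists m, `[< path_of_length u v m >]) with
  | left ex_path => ((ex_minn ex_path)%:Z)%:E
  | right _ => +oo%E
  end.

Definition diam : \bar int :=
  \big[maxe/0%E]_(u in verts H) \big[maxe/0%E]_(v in verts H) dist u v.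

Definition monochromatic (k : nat) (c : {set T} -> 'I_k) : Prop :=
  {in edges H &, forall e f, c e = c f}.

End SubgraphInvariants.

(* A k-edge-coloring of the complete graph on 'I_n is given by a function
   c : {set 'I_n} -> 'I_k, of which only the values on two-element sets
   matter. *)
Definition diam_bound (r k L : nat) : Prop :=
  forall c : {set 'I_(r ^ k + 1)} -> 'I_k,
    exists H : subgraph 'I_(r ^ k + 1),
      [/\ monochromatic H c, r + 1 <= chi H & (diam H <= (L%:Z)%:E)%E].

Lemma colorable_chi (T : finType) (H : subgraph T) (m : nat) :
  chi H <= m -> colorable H m.
Proof.
rewrite /chi; case: ex_minnP => d /asboolP[f [fV fE]] _ dm.
by exists f; split=> // x /fV /leq_trans; apply.
Qed.

Lemma dist_le_card (T : finType) (H : subgraph T) (u v : T) :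
  connect (adj H) u v -> (dist H u v <= (#|T|%:Z)%:E)%E.
Proof.
move=> /connectP[p up ->]; case/shortenP: up => q uq Uq _.
have ex : path_of_length H u (last u q) (size q) by exists q.
rewrite /dist; case: pselect => [h|]; last first.
  by case; exists (size q); apply/asboolP.
case: ex_minnP => m _ /(_ (size q)) mq.
rewrite lee_fin lez_nat; apply: leq_trans (mq _) _; first exact/asboolP.
have := max_card (mem (u :: q)); rewrite (card_uniqP Uq); exact: ltnW.
Qed.

Section Component.
Variables (T : finType) (k : nat) (c : {set T} -> 'I_k) (i : 'I_k).

Definition color_adj : rel T := fun x y => (x != y) && (c [set x; y] == i).

Lemma color_adj_sym : symmetric color_adj.
Proof. by move=> x y; rewrite /color_adj eq_sym finset.setUC. Qed.

Lemma color_connect_sym : connect_sym color_adj.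
Proof. exact/sym_connect_sym/color_adj_sym. Qed.

Lemma component_edgesP (u : T) (e : {set T}) :
  e \in [set e : {set T} | [&& #|e| == 2, c e == i
                             & e \subset [set v | connect color_adj u v]]] ->
  (#|e| == 2) && (e \subset [set v | connect color_adj u v]).
Proof. by rewrite inE => /and3P[-> _ ->]. Qed.

Definition component (u : T) := Subgraph (@component_edgesP u).

Lemma component_mono u : monochromatic (component u) c.
Proof.
by move=> e f; rewrite !inE => /and3P[_ /eqP-> _] /and3P[_ /eqP-> _].
Qed.

Lemma component_adj u x y : connect color_adj u x -> color_adj x y ->
  adj (component u) x y.
Proof.
move=> ux xy; rewrite /adj !inE; have /andP[nxy cxy] := xy.
rewrite cards2 nxy cxy /=; apply/fintype.subsetP => z.
by rewrite !inE => /orP[] /eqP->//; apply: connect_trans ux (connect1 xy).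
Qed.

Lemma component_connect u x y : connect color_adj u x ->
  connect color_adj x y -> connect (adj (component u)) x y.
Proof.
move=> ux /connectP[p]; elim: p x ux => [|z p IHp] x ux /= => [_ ->//|].
move=> /andP[xz zp] yE.
apply: connect_trans (connect1 (component_adj ux xz)) _.
by apply: IHp zp yE; apply: connect_trans ux (connect1 xz).
Qed.

Lemma component_diam u : (diam (component u) <= (#|T|%:Z)%:E)%E.
Proof.
apply/bigmax_leP; split=> [|x]; rewrite ?lee_fin // inE => ux.
apply/bigmax_leP; split=> [|y]; rewrite ?lee_fin // inE => uy.
apply: dist_le_card; apply: component_connect => //.
by apply: connect_trans uy; rewrite color_connect_sym.
Qed.

End Component.

Lemma ex_diam_bound (r k : nat) : exists L, `[< diam_bound r k L >].
Proof.
exists (r ^ k + 1); apply/asboolP => c; apply: contrapT => noH.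
have col (i : 'I_k) u : colorable (component c i u) r.
  apply: colorable_chi; rewrite leqNgt; apply/negP => ltr; apply: noH.
  exists (component c i u); split; [exact: component_mono|by rewrite addn1|].
  by have := component_diam c i u; rewrite card_ord.
pose g i u := projT1 (cid (col i u)).
have gV i u x : connect (color_adj c i) u x -> g i u x < r.
  by rewrite /g; case: cid => f /= [fV _] ux; apply: fV; rewrite inE.
have gE i u x y : adj (component c i u) x y -> g i u x <> g i u y.
  by rewrite /g; case: cid => f /= [_ fE]; apply: fE.
pose rt i x := fingraph.root (color_adj c i) x.
have rtC i x : connect (color_adj c i) (rt i x) x.
  by rewrite (color_connect_sym c i); apply: connect_root.
pose F x := [ffun i => Ordinal (gV i _ x (rtC i x))].
have Finj : injective F.
  move=> x y Fxy; apply/eqP/negPn/negP => nxy.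
  pose i := c [set x; y].
  have xy : color_adj c i x y by rewrite /color_adj nxy /=.
  have rtE : rt i x = rt i y.
    by apply/eqP; rewrite (root_connect (color_connect_sym c i)) connect1.
  apply: (gE i (rt i x) x y); first exact: component_adj (rtC i x) xy.
  have /(congr1 (fun h : {ffun 'I_k -> 'I_r} => val (h i))) := Fxy.
  by rewrite !ffunE /= -rtE.
have := leq_card F Finj.
by rewrite card_ffun !card_ord addn1 ltnn.
Qed.

(* Restricting L to nat loses nothing, since diam is nonnegative. *)
Definition Lr (r k : nat) : nat := ex_minn (ex_diam_bound r k).

(* Main.v *)
(* Suppose that no monochromatic subgraph of diameter at most 2D has chromatic
   number above r, so that for each color i every D-ball of G_i is r-colored,
   and let N = r^k + 1.  To a vertex u attach the unit vector phi(u) in R^N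
   whose c-th coordinate is proportional to (1 + 1/m)^(D - dist(c,u)) - 1 if
   dist(c,u) < D, and 0 otherwise; for D of order m log N these vectors move by
   O(1/m) along edges, so that adjacent u, v have
   <phi(u), phi(v)> >= kappa = 1 - 2/m^2.  Combining phi with the colorings of
   the balls around the c's gives a Gram matrix
     M_i(u,v) = 1 + sum_c phi_c(u) phi_c(v) (r [c colors u and v alike] - 1) / kappa
   with diagonal r + O(r/m^2), with M_i(u,v) <= 0 on edges of color i, and with
   all entries at least -O(1/m^2).  The entrywise product of the M_i dominates
   the all-ones matrix, so its entries add up to at least N^2.  An off-diagonal
   entry of the product has a nonpositive factor, hence when it is positive it
   has two of them, which makes it O(r^(k-2)/m^4).  Thus
   N <= r^k (1 + O(1/m^2))^k (1 + O(N/(r^2 m^4))), which fails for N = r^k + 1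
   as soon as m^2 is a large multiple of k r^k. *)
Require Import Defs.
From mathcomp Require Import all_boot all_order all_algebra.
From mathcomp Require Import all_classical all_reals all_analysis.
From mathcomp Require Import zify ring lra.
Import Order.TTheory GRing.Theory Num.Theory.
Local Open Scope ring_scope.
Set Implicit Arguments.
Unset Strict Implicit.
Unset Printing Implicit Defensive.

(** * Balls in a graph and the truncated distance to their center *)

Section Balls.
Variables (T : finType) (e : rel T).

Fixpoint ball (n : nat) (c : T) : {set T} :=
  if n is n'.+1 then
    (ball n' c :|: [set y | [exists x in ball n' c, e x y]])%SET
  else [set c]%SET.

Lemma ball_leq n p c : (n <= p)%N -> ball n c \subset ball p c.
Proof.
elim: p => [|p IHp]; first by rewrite leqn0 => /eqP->.
rewrite leq_eqVlt => /orP[/eqP->//|/IHp h].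
exact: fintype.subset_trans h (finset.subsetUl _ _).
Qed.

Lemma ball_edge n c x y : e x y -> x \in ball n c -> y \in ball n.+1 c.
Proof.
move=> xy xn; rewrite /= !inE; apply/orP; right.
by apply/existsP; exists x; rewrite xn.
Qed.

(* [D] minus the distance from [c] to [u], truncated at 0. *)
Definition depth (D : nat) (c u : T) : nat := (\sum_(n < D) (u \in ball n c))%N.

Lemma depth_center D c : depth D c c = D.
Proof.
rewrite /depth (eq_bigr (fun=> 1%N)) ?sum1_card ?card_ord // => n _.
by rewrite (fintype.subsetP (ball_leq c (leq0n n))) //= !inE.
Qed.

(** Membership of [u] in one ball passes to [v] in the next, so the two sums compare after an index
    shift; the last summand of [u] is paid for by the successor. *)
Lemma depth_edge D c u v : e u v -> (depth D c u <= (depth D c v).+1)%N.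
Proof.
move=> uv; rewrite /depth; case: D => [|D]; first by rewrite big_ord0.
rewrite big_ord_recr [in leqRHS]big_ord_recl /=.
apply: (@leq_trans (\sum_(i < D) (v \in ball i.+1 c) + 1)%N).
  apply: leq_add; last exact: leq_b1.
  apply: leq_sum => i _; case ui: (u \in ball i c) => //.
  by rewrite (ball_edge uv ui).
by rewrite addn1 ltnS leq_addl.
Qed.

Lemma depth_gt0 D c u : (0 < depth D c u)%N -> u \in ball D c.
Proof.
apply: contraTT => uD; rewrite -leqNgt leqn0; apply/eqP.
apply: big1 => n _; apply/eqP; rewrite eqb0; apply: contra uD.
exact/fintype.subsetP/ball_leq/ltnW/ltn_ord.
Qed.

End Balls.

(** * Diameter from radius *)

Section Subgraphs.
Variables (T : finType) (H : subgraph T).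

Lemma adj_sym x y : adj H x y = adj H y x.
Proof. by rewrite /adj finset.setUC. Qed.

(** [dist] is defined through paths without repeated vertices, so the walk is first shortened to
    one. Walks glued together at a center can then be used directly. *)
Lemma dist_le_size u p : path (adj H) u p ->
  (dist H u (last u p) <= ((size p)%:Z)%:E)%E.
Proof.
case/shortenP=> q uq Uq /uniq_leq_size-/(_ (subseq_uniq _ Uq)) qp.
have {}qp : (size q <= size p)%N by apply: qp; apply: subseq_cons.
have ex : path_of_length H u (last u q) (size q) by exists q.
rewrite /dist; case: pselect => [h|]; last first.
  by case; exists (size q); apply/asboolP.
case: ex_minnP => m _ /(_ (size q)) mq.
by rewrite lee_fin lez_nat (leq_trans _ qp) // mq //; apply/asboolP.
Qed.

Lemma diam_le_radius c n :
  (forall u, u \in verts H ->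
     exists p, [/\ path (adj H) c p, last c p = u & (size p <= n)%N]) ->
  (diam H <= ((2 * n)%:Z)%:E)%E.
Proof.
move=> cH.
apply/bigmax_leP; split=> [|x]; rewrite ?lee_fin // => /cH[p [cp px pn]].
apply/bigmax_leP; split=> [|y]; rewrite ?lee_fin // => /cH[q [cq qy qn]].
have xc : path (adj H) x (rev (belast c p)).
  rewrite -px rev_path; apply: sub_path cp => a b.
  by rewrite adj_sym.
have lxc : last x (rev (belast c p)) = c.
  case: {cp xc pn} p px => [|a p] //= <-.
  by rewrite rev_cons last_rcons.
have xy : path (adj H) x (rev (belast c p) ++ q).
  by rewrite cat_path xc lxc.
have := dist_le_size xy.
rewrite last_cat lxc qy => /le_trans; apply.
rewrite lee_fin lez_nat size_cat size_rev size_belast mul2n -addnn.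
exact: leq_add.
Qed.

End Subgraphs.

(** * Balls of one color as monochromatic subgraphs of small diameter *)

Section ColorBall.
Variables (T : finType) (k : nat) (c : {set T} -> 'I_k) (i : 'I_k).
Let e := color_adj c i.

Lemma color_ball_edgesP n z (f : {set T}) :
  f \in [set f : {set T} | [&& #|f| == 2%N, c f == i & f \subset ball e n z]]%SET ->
  (#|f| == 2%N) && (f \subset ball e n z).
Proof. by rewrite inE => /and3P[-> _ ->]. Qed.

Definition color_ball n z : subgraph T := Subgraph (@color_ball_edgesP n z).

Lemma color_ball_mono n z : monochromatic (color_ball n z) c.
Proof.
by move=> f g; rewrite !inE => /and3P[_ /eqP-> _] /and3P[_ /eqP-> _].
Qed.

Lemma color_ball_adj n z x y : x \in ball e n z -> y \in ball e n z ->
  e x y -> adj (color_ball n z) x y.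
Proof.
move=> xB yB /andP[nxy cxy]; rewrite /adj !inE cards2 nxy cxy /=.
by apply/fintype.subsetP => w; rewrite !inE => /orP[] /eqP->.
Qed.

Lemma color_ball_diam n z : (diam (color_ball n z) <= ((2 * n)%:Z)%:E)%E.
Proof.
apply: (@diam_le_radius _ _ z).
(* The radius [p] grows while the subgraph stays that of radius [n]: a walk built outward from the
   center remains in smaller balls, so all its edges survive in [color_ball n z]. *)
suff H p : (p <= n)%N -> forall u, u \in ball e p z ->
    exists q, [/\ path (adj (color_ball n z)) z q, last z q = u & (size q <= p)%N].
  by move=> u /(H n (leqnn n)).
elim: p => [|p IHp] pn u; first by rewrite inE => /eqP->; exists [::].
move=> uB; have := uB; rewrite [ball _ _ _]/= inE => /orP[/(IHp (ltnW pn))[q [? ? qp]]|].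
  by exists q; split=> //; apply: leqW.
rewrite inE => /existsP[w /andP[wB wu]].
have [q [zq qw qp]] := IHp (ltnW pn) w wB.
exists (rcons q u); rewrite last_rcons size_rcons ltnS; split=> //.
rewrite rcons_path zq qw /=; apply: color_ball_adj wu.
  exact: (fintype.subsetP (ball_leq _ _ (ltnW pn))).
exact: (fintype.subsetP (ball_leq _ _ pn)).
Qed.

End ColorBall.

(** * Entrywise products of Gram matrices, and inner products of nearby vectors *)

Section Gram.
Variable R : rcfType.

Lemma prod_norm_le1 (k : nat) (P : pred 'I_k) (a : 'I_k -> R) :
  (forall i, `|a i| <= 1) -> `|\prod_(i | P i) a i| <= 1.
Proof.
move=> a1; rewrite normr_prod; apply: prodr_ile1 => i _; rewrite normr_ge0 a1 //.
Qed.

(* If the product is positive, a second factor is negative. *)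
Lemma prod_almost_nonneg (k : nat) (a : 'I_k -> R) (eps : R) (j : 'I_k) :
  0 <= eps <= 1 -> (forall i, - eps <= a i <= 1) -> a j <= 0 ->
  \prod_i a i <= eps ^+ 2.
Proof.
move=> /andP[e0 e1] ha aj.
have a1 i : `|a i| <= 1.
  by rewrite ler_norml; have /andP[h ->] := ha i; rewrite andbT; apply: le_trans h; rewrite lerN2.
rewrite (bigD1 j) //=.
have [/forall_inP h|/forall_inPn[l lj al]] := boolP [forall (i | i != j), 0 <= a i].
  apply: (@le_trans _ _ 0); last exact: exprn_ge0.
  by apply: mulr_le0_ge0 => //; apply: prodr_ge0.
rewrite -ltNge in al; rewrite (bigD1 l) //= mulrA.
have /ler_normlP[_ p1] := @prod_norm_le1 k (fun i => (i != j) && (i != l)) a a1.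
have jl0 : 0 <= a j * a l by rewrite mulr_le0 // ltW.
apply: (@le_trans _ _ (a j * a l)); first by rewrite -[leRHS]mulr1 ler_wpM2l.
rewrite expr2 -mulrNN; have /andP[hj _] := ha j; have /andP[hl _] := ha l.
by apply: ler_pM; rewrite ?oppr_ge0 // ?(ltW al) // lerNl.
Qed.

(** The entries of the entrywise product of the [k] Gram matrices are summed and estimated from both
    sides. The coordinate [o], constantly 1, supplies the lower bound. *)
Lemma card_le_prod_gram (T Om : finType) (k : nat) (o : Om)
    (Y : 'I_k -> T -> Om -> R) (B eta : R) :
  0 < B -> 0 <= eta <= B ->
  (forall i u, Y i u o = 1) ->
  (forall i u, \sum_w Y i u w * Y i u w = B) ->
  (forall i u v, - eta <= \sum_w Y i u w * Y i v w <= B) ->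
  (forall u v, u != v -> exists i, \sum_w Y i u w * Y i v w <= 0) ->
  #|T|%:R ^+ 2 <= #|T|%:R * B ^+ k + #|T|%:R ^+ 2 * (B ^+ k * (eta / B) ^+ 2).
Proof.
move=> B0 /andP[eta0 etaB] Yo Yd Yb Yn.
pose M i u v := \sum_w Y i u w * Y i v w.
have Bk : 0 < B ^+ k by rewrite exprn_gt0.
have low : #|T|%:R ^+ 2 <= \sum_u \sum_v \prod_i M i u v.
  (* A product of inner products is the inner product of tensor products, whose coordinates are
     indexed by functions [w]; the total is a sum of squares. *)
  have -> : \sum_u \sum_v \prod_i M i u v =
      \sum_(w : {ffun 'I_k -> Om}) (\sum_u \prod_i Y i u (w i)) ^+ 2.
    rewrite (eq_bigr (fun u => \sum_v \sum_(w : {ffun 'I_k -> Om})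
       (\prod_i Y i u (w i)) * (\prod_i Y i v (w i)))); last first.
      move=> u _; apply: eq_bigr => v _; rewrite /M bigA_distr_bigA /=.
      by apply: eq_bigr => w _; rewrite big_split.
    under eq_bigr do rewrite exchange_big /=.
    rewrite exchange_big /=; apply: eq_bigr => w _.
    by rewrite expr2 mulr_suml; apply: eq_bigr => u _; rewrite mulr_sumr.
  (* The function constantly [o] alone contributes the square of the cardinality. *)
  rewrite (bigD1 [ffun=> o]) //= -[leLHS]addr0 lerD //; last first.
    by apply: sumr_ge0 => w _; apply: sqr_ge0.
  rewrite (eq_bigr (fun=> 1)) ?sumr_const ?cardT -?cardE //.
  by move=> u _; apply: big1 => i _; rewrite ffunE Yo.
apply: le_trans low _.
have up u v : \prod_i M i u v <= (u == v)%:R * B ^+ k + B ^+ k * (eta / B) ^+ 2.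
  have [<-|uv] := eqVneq u v.
    rewrite mul1r (eq_bigr (fun=> B)); last by move=> i _; rewrite /M Yd.
    by rewrite prodr_const card_ord lerDl mulr_ge0 ?sqr_ge0 // ltW.
  rewrite mul0r add0r; have [j Mj] := Yn u v uv.
  (* Scaling by [B] puts every factor between [- eta / B] and 1, as [prod_almost_nonneg]
     requires. *)
  rewrite (eq_bigr (fun i => B * (M i u v / B))); last first.
    by move=> i _; rewrite mulrCA divff ?mulr1 // gt_eqF.
  rewrite big_split prodr_const card_ord ler_pM2l //.
  apply: (@prod_almost_nonneg _ _ _ j).
  - by rewrite divr_ge0 ?(ltW B0) //= ler_pdivrMr ?mul1r.
  - move=> i; rewrite -mulNr ler_pM2r ?invr_gt0 // ler_pdivrMr // mul1r.
    exact: Yb.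
  - by rewrite pmulr_lle0 // invr_gt0.
apply: (@le_trans _ _ (\sum_u \sum_v
    ((u == v)%:R * B ^+ k + B ^+ k * (eta / B) ^+ 2))).
  by apply: ler_sum => u _; apply: ler_sum => v _; apply: up.
rewrite le_eqVlt; apply/orP; left; apply/eqP.
rewrite (eq_bigr (fun u : T => B ^+ k + #|T|%:R * (B ^+ k * (eta / B) ^+ 2))).
  by rewrite sumr_const -[LHS]mulr_natl cardT -cardE; ring.
move=> u _; rewrite big_split /= sumr_const -mulr_suml cardT -cardE.
congr (_ + _); last by rewrite mulr_natl.
rewrite (bigD1 u) //= eqxx big1 ?addr0 ?mul1r // => v /negPf.
by rewrite eq_sym => ->.
Qed.

(** Neighboring exponents change the power by a relative amount 1/m. The bound is symmetric in [a]
    and [b] and multiplicative so that it can be summed against the weights in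
    [inner_ge_of_close]. *)
Lemma sqr_sub_expr (m : R) (a b : nat) : 0 < m ->
  (a <= b.+1)%N -> (b <= a.+1)%N ->
  ((1 + m^-1) ^+ a - (1 + m^-1) ^+ b) ^+ 2 <=
  (1 + m^-1) ^+ a * (1 + m^-1) ^+ b / m ^+ 2.
Proof.
move=> m0; set q := 1 + m^-1.
have q0 : 0 <= q by rewrite addr_ge0 // invr_ge0 ltW.
have im0 : 0 <= m^-1 by rewrite invr_ge0 ltW.
wlog: a b / (a <= b)%N => [H|ab] h1 h2.
  have [ab|/ltnW ba] := leqP a b; first exact: H.
  by rewrite -sqrrN opprB [q ^+ a * _]mulrC; apply: H.
have [->|nab] := eqVneq a b.
  by rewrite subrr expr0n /= mulr_ge0 ?mulr_ge0 ?exprn_ge0 // invr_ge0 exprn_ge0 // ltW.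
have -> : b = a.+1 by apply/eqP; rewrite eqn_leq h2 ltn_neqAle nab ab.
have -> : q ^+ a - q ^+ a.+1 = - (q ^+ a * m^-1) by rewrite exprS /q; ring.
have -> : q ^+ a * q ^+ a.+1 / m ^+ 2 = (q ^+ a * m^-1) ^+ 2 * q.
  by rewrite exprS -exprVn; ring.
by rewrite sqrrN ler_peMr ?sqr_ge0 // /q lerDl.
Qed.

(* [#|T| <= A ^+ 2] ensures that adding 1 to every coordinate of [F], a vector
   of norm [A], at most doubles its norm. *)
Lemma inner_ge_of_close (T : finType) (F G : T -> R) (A B m : R) :
  0 < A -> 0 < B -> 0 < m ->
  \sum_c F c ^+ 2 = A ^+ 2 -> \sum_c G c ^+ 2 = B ^+ 2 ->
  #|T|%:R <= A ^+ 2 -> #|T|%:R <= B ^+ 2 ->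
  (forall c, (F c - G c) ^+ 2 <= (F c + 1) * (G c + 1) / m ^+ 2) ->
  1 - 2 / m ^+ 2 <= \sum_c (F c / A) * (G c / B).
Proof.
move=> A0 B0 m0 FA GB TA TB FG.
(* The bound 4 is 2 + 2, from (K + 1)^2 <= 2 K^2 + 2 and the cardinality bound. *)
have unit_shift (K : T -> R) (C : R) : 0 < C -> \sum_c K c ^+ 2 = C ^+ 2 ->
    #|T|%:R <= C ^+ 2 -> \sum_c ((K c + 1) / C) ^+ 2 <= 4.
  move=> C0 KC TC.
  apply: (@le_trans _ _ (\sum_c (2 / C ^+ 2 * K c ^+ 2 + 2 / C ^+ 2))).
    apply: ler_sum => c _; have -> : 2 / C ^+ 2 * K c ^+ 2 + 2 / C ^+ 2 = (2 * K c ^+ 2 + 2) / C ^+ 2 by ring.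
    rewrite expr_div_n ler_pM2r ?invr_gt0 ?exprn_gt0 //.
    by have := sqr_ge0 (K c - 1); nra.
  rewrite big_split /= -mulr_sumr KC sumr_const -[X in _ + X]mulr_natl -mulrA mulVf ?gt_eqF ?exprn_gt0 //.
  have : #|T|%:R * (2 / C ^+ 2) <= 2 :> R.
    rewrite mulrA ler_pdivrMr ?exprn_gt0 //; lra.
  by lra.
have S4 : \sum_c ((F c + 1) / A) * ((G c + 1) / B) <= 4.
  apply: (@le_trans _ _ (\sum_c (2^-1 * ((F c + 1) / A) ^+ 2 + 2^-1 * ((G c + 1) / B) ^+ 2))).
    by apply: ler_sum => c _; have := sqr_ge0 ((F c + 1) / A - (G c + 1) / B); nra.
  rewrite big_split /= -!mulr_sumr.
  have := unit_shift F A A0 FA TA; have := unit_shift G B B0 GB TB; lra.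
have SD : \sum_c (F c - G c) ^+ 2 <= A * B * 4 / m ^+ 2.
  apply: (@le_trans _ _ (\sum_c ((F c + 1) / A) * ((G c + 1) / B) * (A * B / m ^+ 2))).
    apply: ler_sum => c _; apply: le_trans (FG c) _.
    rewrite le_eqVlt; apply/orP; left; apply/eqP; field.
    by rewrite !gt_eqF.
  rewrite -mulr_suml mulrAC mulrA mulrC mulrA.
  have := ler_wpM2r (ltW (_ : 0 < A * B / m ^+ 2)) S4.
  rewrite divr_gt0 ?mulr_gt0 ?exprn_gt0 // => /(_ isT) h.
  by apply: le_trans (le_trans h _); rewrite le_eqVlt; apply/orP; left; apply/eqP; ring.
(* Polarization; with A^2 + B^2 >= 2AB it turns the distance bound into a lower bound on the inner
   product. *)
have SE : \sum_c (F c - G c) ^+ 2 = A ^+ 2 + B ^+ 2 - 2 * \sum_c F c * G c.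
  rewrite -FA -GB mulr_sumr -big_split -sumrB /=.
  by apply: eq_bigr => c _; ring.
have -> : \sum_c F c / A * (G c / B) = (\sum_c F c * G c) / (A * B).
  rewrite mulr_suml; apply: eq_bigr => c _; field; by rewrite !gt_eqF.
rewrite ler_pdivlMr ?mulr_gt0 // mulrBl mul1r.
rewrite {}SE in SD; have := sqr_ge0 (A - B).
have -> : 2 / m ^+ 2 * (A * B) = (A * B * 4 / m ^+ 2) / 2 by field; rewrite gt_eqF.
nra.
Qed.

End Gram.

(** * The Gram matrix attached to one color *)

Section LocalColoring.
Variable R : rcfType.

(** The vectors e_a - (1/r)(1,...,1) span a regular simplex; after scaling by r, equal colors give r
    - 1 and different ones -1. *)
Lemma simplex_gram (r a b : nat) : (a < r)%N -> (b < r)%N ->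
  \sum_(j < r) ((a == j)%:R - r%:R^-1) * ((b == j)%:R - r%:R^-1) =
  (a == b)%:R - r%:R^-1 :> R.
Proof.
move=> ar br; have r0 : r%:R != 0 :> R by rewrite pnatr_eq0 -lt0n (leq_ltn_trans _ ar).
have sum1 (x : nat) : (x < r)%N -> \sum_(j < r) (x == j)%:R = 1 :> R.
  move=> xr; rewrite (bigD1 (Ordinal xr)) //= eqxx big1 ?addr0 // => j.
  by rewrite -val_eqE /= eq_sym => /negPf->.
have sum2 : \sum_(j < r) ((a == j)%:R * (b == j)%:R) = (a == b)%:R :> R.
  rewrite (bigD1 (Ordinal ar)) //= eqxx mul1r eq_sym big1 ?addr0 // => j.
  by rewrite -val_eqE /= [_ == a]eq_sym => /negPf->; rewrite mul0r.
rewrite (eq_bigr (fun j : 'I_r => (a == j)%:R * (b == j)%:R -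
   r%:R^-1 * (a == j)%:R - r%:R^-1 * (b == j)%:R + r%:R^-1 * r%:R^-1)); last first.
  by move=> j _; ring.
rewrite big_split /= !sumrB sum2 -!mulr_sumr !sum1 // sumr_const card_ord.
by rewrite -[_ *+ r]mulr_natr; field.
Qed.

(* The column [None] of [Y] is the summand 1 of the kernel described at the top. *)
Lemma local_coloring_gram (T : finType) (e : rel T) (r D : nat) (m : R)
    (col : T -> T -> nat) :
  symmetric e -> (0 < r)%N -> 2 <= m ->
  #|T|%:R <= ((1 + m^-1) ^+ D - 1) ^+ 2 ->
  (forall c u, u \in ball e D c -> (col c u < r)%N) ->
  (forall c u v, u \in ball e D c -> v \in ball e D c -> e u v ->
     col c u <> col c v) ->
  let kappa := 1 - 2 / m ^+ 2 in
  exists Y : T -> option (T * 'I_r) -> R,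
    [/\ forall u, Y u None = 1,
        forall u, \sum_w Y u w * Y u w = 1 + (r%:R - 1) / kappa,
        forall u v, - (kappa^-1 - 1) <= \sum_w Y u w * Y v w <=
                    1 + (r%:R - 1) / kappa
      & forall u v, e u v -> \sum_w Y u w * Y v w <= 0].
Proof.
move=> esym r0 m2 TD colr cole kappa.
have m0 : 0 < m by lra.
have k0 : 0 < kappa.
  by rewrite /kappa subr_gt0 ltr_pdivrMr ?exprn_gt0 // mul1r; nra.
have ik0 : 0 < kappa^-1 by rewrite invr_gt0.
have rR : 1 <= r%:R :> R by rewrite ler1n.
have rn0 : r%:R != 0 :> R by rewrite pnatr_eq0 -lt0n.
pose q := 1 + m^-1.
have q1 : 1 <= q by rewrite lerDl invr_ge0 ltW.
pose F u c := q ^+ depth e D c u - 1.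
have F0 u c : 0 <= F u c by rewrite subr_ge0 exprn_ege1.
pose A u := Num.sqrt (\sum_c F u c ^+ 2).
have A2 u : \sum_c F u c ^+ 2 = A u ^+ 2.
  by rewrite sqr_sqrtr // sumr_ge0 // => c _; apply: sqr_ge0.
have TA u : #|T|%:R <= A u ^+ 2.
  apply: le_trans TD _; rewrite -A2 (bigD1 u) //= /F depth_center lerDl.
  by apply: sumr_ge0 => c _; apply: sqr_ge0.
have A0 u : 0 < A u.
  rewrite lt_neqAle sqrtr_ge0 andbT eq_sym -sqrf_eq0 gt_eqF //.
  by apply: lt_le_trans (TA u); rewrite ltr0n; apply/card_gt0P; exists u.
pose phi u c := F u c / A u.
have phi0 u c : 0 <= phi u c by rewrite divr_ge0 // ltW.
have phi2_ge0 u v c : 0 <= phi u c * phi v c by rewrite mulr_ge0.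
have phi1 u : \sum_c phi u c ^+ 2 = 1.
  under eq_bigr do rewrite expr_div_n.
  by rewrite -mulr_suml A2 divff // sqrf_eq0 gt_eqF.
have phi_le1 u v : \sum_c phi u c * phi v c <= 1.
  apply: (@le_trans _ _ (\sum_c (2^-1 * phi u c ^+ 2 + 2^-1 * phi v c ^+ 2))).
    by apply: ler_sum => c _; have := sqr_ge0 (phi u c - phi v c); nra.
  by rewrite big_split /= -!mulr_sumr !phi1; lra.
have phi_ball u c : phi u c != 0 -> u \in ball e D c.
  apply: contraNT => /(contra (@depth_gt0 _ _ _ _ _)).
  by rewrite -leqNgt leqn0 => /eqP d0; rewrite /phi /F d0 subrr mul0r.
have phi_edge u v : e u v -> kappa <= \sum_c phi u c * phi v c.
  move=> uv; apply: inner_ge_of_close => // c.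
  have -> : F u c - F v c = q ^+ depth e D c u - q ^+ depth e D c v.
    by rewrite /F; ring.
  rewrite /F !subrK; apply: sqr_sub_expr => //; apply: depth_edge => //.
  by rewrite esym.
(* The factor r / kappa turns the simplex products [a = b] - 1/r into (r [a = b] - 1) / kappa. *)
pose s := Num.sqrt (r%:R / kappa).
have s2 : s * s = r%:R / kappa.
  by rewrite -expr2 sqr_sqrtr // divr_ge0 ?ler0n ?(ltW k0).
pose Y u (w : option (T * 'I_r)) := if w is Some (c, j) then
  s * (phi u c * ((col c u == j)%:R - r%:R^-1)) else 1.
have YE u v : \sum_w Y u w * Y v w =
    1 + \sum_c phi u c * phi v c * (r%:R * (col c u == col c v)%:R - 1) / kappa.
  rewrite (bigD1 None) //= mulr1; congr (_ + _).
  rewrite (reindex_onto Some (odflt (u, Ordinal r0))) /=; last by case.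
  rewrite (eq_bigl predT); last by move=> x; rewrite /= eqxx.
  rewrite (eq_bigr (fun p => (fun c j => Y u (Some (c, j)) * Y v (Some (c, j))) p.1 p.2));
    last by case.
  rewrite -(pair_bigA _ (fun c j => Y u (Some (c, j)) * Y v (Some (c, j)))) /=.
  apply: eq_bigr => c _.
  rewrite (eq_bigr (fun j : 'I_r => s * s * (phi u c * phi v c) *
    (((col c u == j)%:R - r%:R^-1) * ((col c v == j)%:R - r%:R^-1)))); last first.
    by move=> j _; ring.
  rewrite -mulr_sumr s2.
  (* Colors are known to lie below [r] only inside the ball of [c]; outside it [phi] vanishes, and
     with it the whole term. *)
  have [pu|/phi_ball pu] := eqVneq (phi u c) 0; first by rewrite pu !(mul0r, mulr0).
  have [pv|/phi_ball pv] := eqVneq (phi v c) 0; first by rewrite pv !(mul0r, mulr0).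
  rewrite simplex_gram ?colr //; field.
  by rewrite rn0 gt_eqF.
exists Y; split=> //.
- move=> u; rewrite YE; congr (_ + _).
  under eq_bigr do rewrite eqxx mulr1 -mulrA -expr2.
  by rewrite -mulr_suml phi1 mul1r.
- move=> u v; rewrite YE; apply/andP; split.
    apply: (@le_trans _ _ (1 + \sum_c phi u c * phi v c * - kappa^-1)).
      rewrite -mulr_suml; have := ler_wpM2r (ltW ik0) (phi_le1 u v); lra.
    rewrite lerD2l; apply: ler_sum => c _; rewrite -[leRHS]mulrA ler_wpM2l //.
    by rewrite -[- kappa^-1]mulN1r ler_wpM2r ?(ltW ik0) // lerDr mulr_ge0.
  rewrite lerD2l; apply: (@le_trans _ _ (\sum_c phi u c * phi v c * ((r%:R - 1) / kappa))).
    apply: ler_sum => c _; rewrite -[leLHS]mulrA ler_wpM2l //.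
    rewrite ler_wpM2r ?(ltW ik0) // lerD2r.
    by case: (_ == _); rewrite ?mulr1 ?mulr0 ?ler0n.
  rewrite -mulr_suml; have : 0 <= (r%:R - 1) / kappa.
    by rewrite divr_ge0 ?(ltW k0) // subr_ge0.
  by move=> /ler_wpM2r/(_ _ _ (phi_le1 u v)); rewrite mul1r.
- move=> u v uv; rewrite YE.
  (* On an edge every contributing ball colors [u] and [v] differently, so each bracket is -1. The
     sum is then at most -1 by [phi_edge], which is why the kernel is divided by [kappa]. *)
  have -> : \sum_c phi u c * phi v c * (r%:R * (col c u == col c v)%:R - 1) / kappa =
      \sum_c phi u c * phi v c * - kappa^-1.
    apply: eq_bigr => c _.
    have [pu|/phi_ball pu] := eqVneq (phi u c) 0; first by rewrite pu !(mul0r, mulr0).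
    have [pv|/phi_ball pv] := eqVneq (phi v c) 0; first by rewrite pv !(mul0r, mulr0).
    by move/eqP/negPf: (cole c u v pu pv uv) => ->; rewrite mulr0 sub0r; ring.
  rewrite -mulr_suml mulrN subr_le0 ler_pdivlMr // mul1r.
  exact: phi_edge.
Qed.

End LocalColoring.

(** * Numerical contradiction for large [m] *)

Section Numeric.
Variable R : realFieldType.

(** In the induction the quadratic term 2k x^2 is at most x, because 2k x <= 1. *)
Lemma bernoulli_upper (k : nat) (x : R) :
  0 <= x -> 2 * k%:R * x <= 1 -> (1 + x) ^+ k <= 1 + 2 * k%:R * x.
Proof.
move=> x0; elim: k => [|k IHk]; first by rewrite expr0 mulr0 mul0r addr0.
rewrite -natr1 => h; have {}IHk := IHk ltac:(nra).
rewrite exprS; apply: le_trans (ler_wpM2l _ IHk) _; first by lra.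
by have : 0 <= k%:R :> R by []; nra.
Qed.

Lemma gram_bound_contra (r k : nat) (m N kappa B : R) :
  (2 <= r)%N -> (1 <= k)%N -> 2 <= m -> 32 * k%:R * r%:R ^+ k <= m ^+ 2 ->
  N = r%:R ^+ k + 1 -> kappa = 1 - 2 / m ^+ 2 -> B = 1 + (r%:R - 1) / kappa ->
  N * B ^+ k + N ^+ 2 * (B ^+ k * ((kappa^-1 - 1) / B) ^+ 2) < N ^+ 2.
Proof.
move=> r2 k1 m2 mk NE kappaE BE0.
have rR : 2 <= r%:R :> R by rewrite (ler_nat _ 2).
have kR : 1 <= k%:R :> R by rewrite ler1n.
have mm : 4 <= m ^+ 2 by nra.
pose d := kappa^-1 - 1.
have u0 : 0 < 2 / m ^+ 2 by rewrite divr_gt0 //; lra.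
have u2 : 2 / m ^+ 2 <= 2^-1 by rewrite ler_pdivrMr; lra.
have k0 : 0 < kappa by rewrite kappaE; lra.
have dE : d = 2 / m ^+ 2 / kappa.
  have -> : 2 / m ^+ 2 = 1 - kappa by rewrite kappaE; ring.
  by rewrite /d; field; rewrite gt_eqF.
have d0 : 0 <= d by rewrite dE divr_ge0 // ltW.
set n := r%:R ^+ k : R; rewrite -/n in NE mk.
have n2 : 2 <= n by rewrite (le_trans rR) // -[leLHS]expr1 ler_weXn2l //; lra.
(* Since [kappa] is at least 1/2, d <= 4 / m^2; the constant 32 is 8 times this 4. It keeps B^k
   within 1/4 of n. *)
have d4 : 8 * k%:R * n * d <= 1.
  have : d <= 4 / m ^+ 2.
    rewrite dE ler_pdivrMr // kappaE.
    have -> : 4 / m ^+ 2 = 2 * (2 / m ^+ 2) by ring.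
    by nra.
  move=> h; apply: (@le_trans _ _ (8 * k%:R * n * (4 / m ^+ 2))).
    by rewrite ler_wpM2l // mulr_ge0; lra.
  rewrite mulrA ler_pdivrMr; lra.
have B0 : 0 < B by rewrite BE0 addr_gt0 // divr_gt0 // ; lra.
have BE : B = r%:R + (r%:R - 1) * d by rewrite BE0 /d; ring.
have Br : r%:R <= B by rewrite BE lerDl mulr_ge0 //; lra.
have Bk : B ^+ k <= n * (1 + 2 * k%:R * d).
  apply: (@le_trans _ _ ((r%:R * (1 + d)) ^+ k)).
    by rewrite lerXn2r ?nnegrE ?BE //; nra.
  rewrite exprMn ler_wpM2l ?exprn_ge0 //; apply: bernoulli_upper => //; nra.
have dB : d / B <= d / 2 by rewrite ler_wpM2l // lef_pV2 ?posrE //; lra.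
have dB0 : 0 <= d / B by rewrite divr_ge0 // ltW.
rewrite -/d; set y := d / B in dB dB0 *.
have Bk0 : 0 <= B ^+ k by rewrite exprn_ge0 // ltW.
have Bn : 4 * B ^+ k <= 4 * n + 1 by nra.
have dn : 8 * n * d <= 1 by nra.
have ny : 16 * n * y <= 1 by nra.
have N0 : 0 < N by lra.
have ny2 : (n * y) ^+ 2 <= (1 / 16) ^+ 2.
  have n0 : 0 <= n by lra.
  have ny1 : n * y <= 1 / 16 by lra.
  have ny0 : 0 <= n * y by rewrite mulr_ge0.
  by apply: lerXn2r => //; rewrite nnegrE; lra.
have y20 : 0 <= y ^+ 2 by exact: sqr_ge0.
(* Here N <= 3n/2 because n >= 2, and 3/512 = (3/2)(1/16)^2. *)
have nNy : n * (N * y ^+ 2) <= 3 / 512.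
  have : n * (N * y ^+ 2) <= n * (3 / 2 * n * y ^+ 2).
    by rewrite ler_wpM2l ?ler_wpM2r //; lra.
  move=> h; apply: le_trans h _.
  have -> : n * (3 / 2 * n * y ^+ 2) = 3 / 2 * (n * y) ^+ 2 by ring.
  lra.
have Ny : 0 <= N * y ^+ 2 by rewrite mulr_ge0 // ltW.
(* The total excess over n stays below 1/4 + 3/512 + 3/4096, hence below the 1 by which N exceeds
   n. *)
have key : B ^+ k * (1 + N * y ^+ 2) < N.
  have : B ^+ k * (1 + N * y ^+ 2) <= (n + 1 / 4) * (1 + N * y ^+ 2).
    by rewrite ler_wpM2r //; lra.
  by nra.
have -> : N * B ^+ k + N ^+ 2 * (B ^+ k * y ^+ 2) = N * (B ^+ k * (1 + N * y ^+ 2)) by ring.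
by rewrite [N ^+ 2]expr2 ltr_pM2l.
Qed.

End Numeric.

(** * Choice of the radius and the resulting diameter bound *)

Lemma bernoulli_lower (R : realFieldType) (x : R) (n : nat) :
  0 <= x -> 1 + n%:R * x <= (1 + x) ^+ n.
Proof.
move=> x0; elim: n => [|n IHn]; first by rewrite expr0 mul0r addr0.
rewrite exprS -natr1; apply: le_trans (ler_wpM2l _ IHn); last by lra.
by have : 0 <= n%:R :> R by []; nra.
Qed.

(** By Bernoulli every [m] steps at least double the weight, so radius [m * s] reaches 2^s. This
    makes the coordinate of a vertex at itself large enough for the norm condition of
    [local_coloring_gram]. *)
Lemma ball_weight_ge (R : realFieldType) (m s N : nat) :
  (0 < m)%N -> (0 < N)%N -> (N + 1 <= 2 ^ s)%N ->
  N%:R <= ((1 + m%:R^-1) ^+ (m * s) - 1) ^+ 2 :> R.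
Proof.
move=> m0 N0 Ns; have mR : m%:R != 0 :> R by rewrite pnatr_eq0 -lt0n.
have q2 : 2 <= (1 + m%:R^-1) ^+ m :> R.
  have := @bernoulli_lower R m%:R^-1 m; rewrite invr_ge0 divff // // => /(_ (ler0n _ _)); lra.
have qs : N%:R + 1 <= (1 + m%:R^-1) ^+ (m * s) :> R.
  apply: (@le_trans _ _ (2 ^+ s)); first by rewrite natr1 -addn1 -natrX ler_nat.
  by rewrite exprM lerXn2r ?nnegrE //; lra.
have N1 : 1 <= N%:R :> R by rewrite ler1n.
by nra.
Qed.

Lemma diam_bound_of_sqr (R : rcfType) (r k m s : nat) :
  (2 <= r)%N -> (1 <= k)%N -> (2 <= m)%N -> (32 * k * r ^ k <= m ^ 2)%N ->
  (r ^ k + 2 <= 2 ^ s)%N -> diam_bound r k (2 * (m * s)).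
Proof.
move=> r2 k1 m2 mk rs c; apply: contrapT => noH.
set T : finType := 'I_(r ^ k + 1); set D := (m * s)%N.
have col i z : colorable (color_ball c i D z) r.
  apply: colorable_chi; rewrite leqNgt; apply/negP => ltr; apply: noH.
  exists (color_ball c i D z); split; last exact: color_ball_diam.
    exact: color_ball_mono.
  by rewrite addn1.
pose g i z := projT1 (cid (col i z)).
have gV i z x : x \in ball (color_adj c i) D z -> (g i z x < r)%N.
  by rewrite /g; case: cid => f /= [fV _] zx; apply: fV.
have gE i z x y : x \in ball (color_adj c i) D z ->
    y \in ball (color_adj c i) D z -> color_adj c i x y -> g i z x <> g i z y.
  move=> xB yB xy; rewrite /g; case: cid => f /= [_ fE]; apply: fE.
  exact: color_ball_adj.
have mR : 2 <= m%:R :> R by rewrite (ler_nat R 2 m).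
have cardT : #|T| = (r ^ k + 1)%N by rewrite card_ord.
have wT : #|T|%:R <= ((1 + m%:R^-1) ^+ D - 1) ^+ 2 :> R.
  by rewrite cardT; apply: ball_weight_ge; lia.
have /choice[Y YP] i := local_coloring_gram (@color_adj_sym _ _ c i) (ltnW r2) mR wT
  (@gV i) (@gE i).
pose kappa : R := 1 - 2 / m%:R ^+ 2.
have k0 : 0 < kappa.
  by rewrite /kappa subr_gt0 ltr_pdivrMr ?exprn_gt0 // ?mul1r; nra.
have kappa1 : kappa <= 1 by rewrite /kappa gerBl divr_ge0 ?exprn_ge0.
have ik1 : 1 <= kappa^-1 by rewrite invf_ge1.
have rR : 2 <= r%:R :> R by rewrite (ler_nat R 2 r).
pose B : R := 1 + (r%:R - 1) / kappa.
have ub : #|T|%:R ^+ 2 <= #|T|%:R * B ^+ k +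
    #|T|%:R ^+ 2 * (B ^+ k * ((kappa^-1 - 1) / B) ^+ 2).
  apply: (@card_le_prod_gram R T _ k None Y).
  - by rewrite /B; have := divr_ge0 (_ : 0 <= r%:R - 1) (ltW k0); lra.
  - by rewrite /B; apply/andP; split; nra.
  - by move=> i; case: (YP i).
  - by move=> i; case: (YP i).
  - by move=> i; case: (YP i).
  (* The color of the edge itself provides the nonpositive factor. *)
  move=> u v uv; exists (c [set u; v]%SET).
  case: (YP (c [set u; v]%SET)) => _ _ _; apply.
  by rewrite /color_adj uv /=.
have /negP[] : ~~ (#|T|%:R ^+ 2 <= #|T|%:R * B ^+ k +
    #|T|%:R ^+ 2 * (B ^+ k * ((kappa^-1 - 1) / B) ^+ 2)).
  rewrite -ltNge; apply: (gram_bound_contra r2 k1 mR) => //.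
    by rewrite -!natrX -!natrM ler_nat.
  by rewrite cardT natrD natrX.
exact: ub.
Qed.

(** * The explicit constant *)

Lemma theorem1p3_explicit (R : realType) (r k : nat) :
  (2 <= r)%N -> (1 <= k)%N ->
  (Lr r k)%:R <= 72 / ln 2 * k%:R `^ (3 / 2) * r%:R `^ (k%:R / 2) * ln r%:R :> R.
Proof.
move=> r2 k1; pose t := trunc_log 2 r.
have rR : 2 <= r%:R :> R by rewrite (ler_nat R 2 r).
have kR : 1 <= k%:R :> R by rewrite ler1n.
have t1 : (1 <= t)%N by rewrite trunc_log_gt0.
have ln20 : 0 < ln 2 :> R by rewrite ln_gt0 ?ltr1n.
have tln : t%:R * ln 2 <= ln r%:R :> R.
  rewrite mulr_natl -lnXn // ler_ln ?posrE ?exprn_gt0 //; last by lra.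
  by rewrite -natrX ler_nat trunc_logP // ltnW.
(* From r < 2^(t+1) and t >= 1 follows 2r <= 2^(t+2) <= 2^(3t), and r^k + 2 <= (2r)^k. *)
have rs : (r ^ k + 2 <= 2 ^ (3 * k * t))%N.
  have rt : (2 * r <= 2 ^ (3 * t))%N.
    have := trunc_log_ltn r (isT : (1 < 2)%N); rewrite -/t => h.
    apply: (@leq_trans (2 * 2 ^ t.+1)); first by rewrite leq_mul2l ltnW.
    by rewrite -expnS leq_exp2l //; lia.
  have -> : (3 * k * t = 3 * t * k)%N by lia.
  rewrite expnM; apply: (@leq_trans ((2 * r) ^ k)); last by rewrite leq_exp2r.
  have rk : (2 <= r ^ k)%N 
    by apply: (leq_trans r2); rewrite -[leqLHS]expn1 leq_exp2l.
  have k2 : (2 <= 2 ^ k)%N by rewrite -[leqLHS]expn1 leq_pexp2l.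
  by rewrite expnMn; nia.
(* The square 36 covers the required 32; rounding [x] up to [m] costs at most a factor 2, as x >=
   1. *)
pose x : R := 6 * (k%:R `^ 2^-1 * r%:R `^ (k%:R / 2)).
have x2 : x ^+ 2 = 36 * k%:R * r%:R ^+ k.
  rewrite /x !exprMn powRrM powR_mulrn ?ler0n // !powR12_sqrt ?exprn_ge0 //.
  by rewrite !sqr_sqrtr ?exprn_ge0 //; ring.
have x0 : 0 <= x by rewrite !mulr_ge0 ?powR_ge0.
have n1 : 1 <= r%:R ^+ k :> R by rewrite exprn_ege1 //; lra.
have x1 : 1 <= x by rewrite -(@ler_pXn2r _ 2) ?nnegrE // expr1n x2; nra.
pose m := (Num.truncn x).+1.
have /andP[mx xm] := truncn_itv x0.
have mle : m%:R <= 2 * x by rewrite /m -natr1; lra.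
have m2 : (2 <= m)%N by rewrite -(ltr_nat R) (le_lt_trans x1 xm).
have mk : (32 * k * r ^ k <= m ^ 2)%N.
  rewrite -(ler_nat R) !natrM !natrX; apply: (@le_trans _ _ (x ^+ 2)).
    by rewrite x2; nra.
  by rewrite lerXn2r ?nnegrE // ltW.
have Lle : (Lr r k <= 2 * (m * (3 * k * t)))%N.
  rewrite /Lr; case: ex_minnP => L _; apply; apply/asboolP.
  exact: (@diam_bound_of_sqr R).
apply: (@le_trans _ _ (2 * (m * (3 * k * t)))%:R); first by rewrite ler_nat.
rewrite !natrM.
(* 72 = 2 * 2 * 6 * 3: diameter against radius, rounding of [m], the 6 in [x], and the 3 in the
   exponent 3kt. *)
have -> : 72 / ln 2 * k%:R `^ (3 / 2) * r%:R `^ (k%:R / 2) * ln r%:R =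
    2 * (2 * x) * (3 * k%:R) * (ln r%:R / ln 2) :> R.
  have -> : 3 / 2 = 1 + 2^-1 :> R by field.
  rewrite powRD; last by apply/implyP => _; lra.
  by rewrite powRr1 ?ler0n // /x; ring.
have tl : t%:R <= ln r%:R / ln 2 :> R by rewrite ler_pdivlMr.
have -> : 2 * (m%:R * (3 * k%:R * t%:R)) = 2 * m%:R * (3 * k%:R) * t%:R :> R by ring.
rewrite ler_pM ?mulr_ge0 ?ler0n // ler_wpM2r ?mulr_ge0 ?ler0n //.
by rewrite ler_wpM2l.
Qed.

Theorem theorem1p3 (R : realType) :
  (exists C : R, 0 < C /\
     forall r k : nat, (2 <= r)%N -> (1 <= k)%N ->
       (Lr r k)%:R <= C * k%:R `^ (3 / 2) * r%:R `^ (k%:R / 2) * ln r%:R)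
  /\
  (forall r : nat, (2 <= r)%N ->
     exists Cr : R, 0 < Cr /\
       forall k : nat, (1 <= k)%N ->
         (Lr r k)%:R <= Cr * k%:R `^ (3 / 2) * r%:R `^ (k%:R / 2)).
Proof.
have C0 : 0 < 72 / ln 2 :> R by rewrite divr_gt0 // ln_gt0 ?ltr1n.
split; first by exists (72 / ln 2); split=> // r k; apply: theorem1p3_explicit.
move=> r r2; exists (72 / ln 2 * ln r%:R); split=> [|k k1].
  by rewrite mulr_gt0 // ln_gt0 ?ltr1n.
by rewrite 2![_ * ln _ * _]mulrAC; apply: theorem1p3_explicit.
Qed.
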